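(* There is no formal context whose concept algebra is isomorphic to a complete atomfree Boolean algebra.
   Context: A Boolean algebra is atomfree if it has no atoms (no minimal nonzero elements); it is complete if every subset has a supremum and an infimum. A Boolean algebra $(B,\wedge,\vee,\bar{\phantom{a}},0,1)$ is regarded as the algebra $(B,\wedge,\vee,{}^{\triangle},{}^{\bigtriangledown},0,1)$ with duplicated complementation, i.e. $x^{\triangle}:=\bar{x}=:x^{\bigtriangledown}$. A formal context is a triple $(G,M,I)$ of sets with $I\subseteq G\times M$. For $A\subseteq G$ and $B\subseteq M$ put $A':=\{m\in M\mid \forall g\in A,\ (g,m)\in I\}$ and $B':=\{g\in G\mid \forall m\in B,\ (g,m)\in I\}$. A formal concept is a pair $(A,B)$ with $A\subseteq G$, $B\subseteq M$, $A'=B$, $B'=A$. The set $\mathfrak{B}(G,M,I)$ of all formal concepts is ordered by $(A,B)\leq(C,D):\iff A\subseteq C$ and is a complete lattice under this order, with meet $\wedge$, join $\vee$, least element $0$ and greatest element $1$. The weak negation of $(A,B)$ is $(A,B)^{\triangle}:=((G\setminus A)'',(G\setminus A)')$ and the weak opposition is $(A,B)^{\bigtriangledown}:=((M\setminus B)',(M\setminus B)'')$. The concept algebra of $(G,M,I)$ is $(\mathfrak{B}(G,M,I),\wedge,\vee,{}^{\triangle},{}^{\bigtriangledown},0,1)$. Isomorphism means isomorphism of algebras with respect to all operations $\wedge,\vee,{}^{\triangle},{}^{\bigtriangledown},0,1$.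
   Formalization: The Boolean algebra is assumed nontrivial (0 ≠ 1); the one-element Boolean algebra is complete and vacuously atomfree, and it is the concept algebra of the empty context, so the claim fails for it. *)

(* Defs.v *)
From HB Require Import structures.
From mathcomp Require Import all_boot all_order all_classical.

Set Implicit Arguments.
Unset Strict Implicit.
Unset Printing Implicit Defensive.

Import Order.TTheory.
Local Open Scope classical_set_scope.

Record formal_context := FormalContext {
  object : Type;
  attribute : Type;
  incidence : set (object * attribute)
}.

Section Derivation.
Variable K : formal_context.
Implicit Types (A : set (object K)) (B : set (attribute K)).

(* The two maps written with a prime: [common_attributes A] is A' for a set A
   of objects, [common_objects B] is B' for a set B of attributes. *)
Definition common_attributes A : set (attribute K) :=
  [set m | forall g, A g -> incidence (g, m)].

Definition common_objects B : set (object K) :=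
  [set g | forall m, B m -> incidence (g, m)].

Lemma common_attributesS A1 A2 :
  A1 `<=` A2 -> common_attributes A2 `<=` common_attributes A1.
Proof. by move=> s m Am g /s; exact: Am. Qed.

Lemma common_objectsS B1 B2 :
  B1 `<=` B2 -> common_objects B2 `<=` common_objects B1.
Proof. by move=> s g Bg m /s; exact: Bg. Qed.

Lemma sub_common_objectsK A : A `<=` common_objects (common_attributes A).
Proof. by move=> g Ag m; exact. Qed.

Lemma sub_common_attributesK B : B `<=` common_attributes (common_objects B).
Proof. by move=> m Bm g; exact. Qed.

Lemma common_attributesK A :
  common_attributes (common_objects (common_attributes A)) =
  common_attributes A.
Proof.
apply/seteqP; split; last exact: sub_common_attributesK.
exact/common_attributesS/sub_common_objectsK.
Qed.

Lemma common_objectsK B :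
  common_objects (common_attributes (common_objects B)) = common_objects B.
Proof.
apply/seteqP; split; last exact: sub_common_objectsK.
exact/common_objectsS/sub_common_attributesK.
Qed.

End Derivation.

Record concept (K : formal_context) := Concept {
  extent : set (object K);
  intent : set (attribute K);
  extentK : common_attributes extent = intent;
  intentK : common_objects intent = extent
}.

Section ConceptLattice.
Variable K : formal_context.
Implicit Types (A : set (object K)) (B : set (attribute K)).
Implicit Types (x y z : concept K).

Lemma concept_eq x y : extent x = extent y -> x = y.
Proof.
case: x y => [A B AB BA] [C D CD DC] /= eAC.
have eBD : B = D by rewrite -AB -CD eAC.
move: CD DC; rewrite -eAC -eBD => CD DC.
by congr Concept; exact: Prop_irrelevance.
Qed.

(* (A'', A') *)
Definition concept_of_objects A : concept K :=
  Concept (common_attributesK A) erefl.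

(* (B', B'') *)
Definition concept_of_attributes B : concept K :=
  Concept erefl (common_objectsK B).

HB.instance Definition _ := gen_eqMixin (concept K).
HB.instance Definition _ := gen_choiceMixin (concept K).

Definition concept_le x y : bool := `[< extent x `<=` extent y >].

Fact concept_le_refl : reflexive concept_le.
Proof. by move=> x; apply/asboolP. Qed.

Fact concept_le_anti : antisymmetric concept_le.
Proof.
move=> x y /andP[/asboolP xy /asboolP yx].
by apply: concept_eq; apply/seteqP.
Qed.

Fact concept_le_trans : transitive concept_le.
Proof.
move=> y x z /asboolP xy /asboolP yz.
exact/asboolP/(subset_trans xy yz).
Qed.

Fact concept_display : Order.disp_t. Proof. exact: Order.Disp tt tt. Qed.

HB.instance Definition _ := Order.Le_isPOrder.Build concept_display (concept K)
  concept_le_refl concept_le_anti concept_le_trans.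

Lemma concept_leP x y : reflect (extent x `<=` extent y) (x <= y)%O.
Proof. exact: asboolP. Qed.

Lemma sub_extent x y : intent y `<=` intent x -> extent x `<=` extent y.
Proof. by rewrite -(intentK x) -(intentK y); exact: common_objectsS. Qed.

Lemma sub_intent x y : extent x `<=` extent y -> intent y `<=` intent x.
Proof. by rewrite -(extentK x) -(extentK y); exact: common_attributesS. Qed.

Definition concept_meet x y := concept_of_attributes (intent x `|` intent y).
Definition concept_join x y := concept_of_objects (extent x `|` extent y).

Fact concept_meetP x y z : (x <= concept_meet y z)%O = (x <= y)%O && (x <= z)%O.
Proof.
apply/concept_leP/andP => [s|[/concept_leP xy /concept_leP xz]].
  split; apply/concept_leP => g /s /= gyz; rewrite -intentK => m ?; apply: gyz.
    by left.
  by right.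
move=> g xg m [].
  by rewrite -extentK; apply; exact: xy.
by rewrite -extentK; apply; exact: xz.
Qed.

Fact concept_joinP x y z : (concept_join x y <= z)%O = (x <= z)%O && (y <= z)%O.
Proof.
apply/concept_leP/andP => [s|[/concept_leP xz /concept_leP yz]].
  by split; apply/concept_leP => g ?; apply/s/sub_common_objectsK; [left|right].
rewrite -(intentK z) -(extentK z) /=.
apply/common_objectsS/common_attributesS.
by move=> g [/xz|/yz].
Qed.

HB.instance Definition _ :=
  Order.POrder_MeetJoin_isLattice.Build concept_display (concept K)
    concept_meetP concept_joinP.

Definition concept_bottom := concept_of_attributes setT.
Definition concept_top := concept_of_objects setT.

Fact concept_le0x x : (concept_bottom <= x)%O.
Proof. by apply/concept_leP/sub_extent => m xm g; exact. Qed.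

Fact concept_lex1 x : (x <= concept_top)%O.
Proof. by apply/concept_leP => g _; exact: sub_common_objectsK. Qed.

HB.instance Definition _ :=
  Order.hasBottom.Build concept_display (concept K) concept_le0x.
HB.instance Definition _ :=
  Order.hasTop.Build concept_display (concept K) concept_lex1.

Definition weak_negation x := concept_of_objects (~` extent x).
Definition weak_opposition x := concept_of_attributes (~` intent x).

End ConceptLattice.

(* Algebras of the signature (2, 2, 1, 1, 0, 0), with no axioms. *)
Record algebra := Algebra {
  carrier :> Type;
  meet_op : carrier -> carrier -> carrier;
  join_op : carrier -> carrier -> carrier;
  triangle_op : carrier -> carrier;
  bigtriangledown_op : carrier -> carrier;
  zero_op : carrier;
  one_op : carrier
}.

Definition isomorphism (X Y : algebra) (f : X -> Y) : Prop :=
  bijective f /\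
  [/\ {morph f : x y / meet_op x y >-> meet_op x y},
      {morph f : x y / join_op x y >-> join_op x y},
      {morph f : x / triangle_op x >-> triangle_op x} &
      {morph f : x / bigtriangledown_op x >-> bigtriangledown_op x}] /\
  f (zero_op X) = zero_op Y /\ f (one_op X) = one_op Y.

Definition isomorphic (X Y : algebra) : Prop :=
  exists f : X -> Y, isomorphism f.

Definition concept_algebra (K : formal_context) : algebra :=
  @Algebra (concept K) Order.meet Order.join
    (@weak_negation K) (@weak_opposition K) Order.bottom Order.top.

(* Duplicated complementation: both unary operations are the complement. *)
Definition boolean_algebra (d : Order.disp_t) (B : ctbDistrLatticeType d) :
    algebra :=
  @Algebra B Order.meet Order.join Order.compl Order.compl
    Order.bottom Order.top.

Definition complete_order (d : Order.disp_t) (T : porderType d) : Prop :=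
  forall A : set T, supremums A !=set0 /\ infimums A !=set0.

Definition atom (d : Order.disp_t) (T : bPOrderType d) (a : T) : Prop :=
  a <> \bot%O /\ forall x : T, x <> \bot%O -> (x <= a)%O -> x = a.

Definition atomfree (d : Order.disp_t) (T : bPOrderType d) : Prop :=
  forall a : T, ~ atom a.

(* Main.v *)
Require Import Defs.
From mathcomp Require Import all_boot all_order all_classical.

(** For an object [g] and a concept [x], either [g] lies in the extent of [x]
    or it lies in the extent of the weak negation of [x]. If weak negation is a
    complementation, a concept below the object concept of [g] is therefore
    either equal to it or disjoint from itself, so every object concept is
    zero or an atom. Object concepts are join-dense; without atoms they all
    vanish, and the concept lattice is trivial. *)

Import Order.Theory.

Definition object_concept {K : formal_context} (g : object K) : concept K :=
  concept_of_objects [set g]%classic.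

Lemma object_concept_le {K : formal_context} (g : object K) (x : concept K) :
  (object_concept g <= x)%O <-> extent x g.
Proof.
split=> [/concept_leP|xg]; first by apply; exact: sub_common_objectsK.
apply/concept_leP; rewrite -(intentK x) -(extentK x) /=.
by apply/common_objectsS/common_attributesS => _ ->.
Qed.

Lemma object_concept_le_or {K : formal_context} (g : object K) (x : concept K) :
  (object_concept g <= x)%O \/ (object_concept g <= weak_negation x)%O.
Proof.
have [xg|nxg] := pselect (extent x g); [left|right]; apply/object_concept_le=> //.
(* The complement of [extent x] lies in its closure, the extent of [weak_negation x]. *)
exact: sub_common_objectsK.
Qed.

Lemma object_concept_atom {K : formal_context} (g : object K) :
  (forall x : concept K, x `&` weak_negation x = \bot)%O ->
  object_concept g <> \bot%O -> atom (object_concept g).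
Proof.
move=> wnegI g_neq0; split=> // x x_neq0 xg.
have [gx|gNx] := object_concept_le_or g x.
  by apply/eqP; rewrite eq_le xg.
(* Now [x <= object_concept g <= weak_negation x], so [x] is its own meet with [weak_negation x]. *)
by case: x_neq0; rewrite -(wnegI x); apply/esym/meet_l/(le_trans xg).
Qed.

Lemma object_concept_eq0 {K : formal_context} :
  (forall g : object K, object_concept g = \bot%O) ->
  (\bot : concept K)%O = \top%O.
Proof.
move=> g_eq0; apply/eqP; rewrite eq_le le0x /=.
by apply/concept_leP => g _; apply/object_concept_le; rewrite g_eq0.
Qed.

Lemma atom_meet_iso {d1 d2 : Order.disp_t} {S : bLatticeType d1}
    {T : bLatticeType d2} {f : S -> T} {a : S} :
  bijective f -> {morph f : x y / x `&` y >-> x `&` y}%O -> f \bot%O = \bot%O ->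
  atom a -> atom (f a).
Proof.
move=> bij_f fI f0 [a_neq0 a_min].
have f_inj := bij_inj bij_f; have [h _ hK] := bij_f.
split=> [fa0|y y_neq0 le_y_fa]; first by apply/a_neq0/f_inj; rewrite fa0 f0.
rewrite -(hK y); congr f; apply: a_min => [hy0|].
  by apply: y_neq0; rewrite -(hK y) hy0 f0.
(* Written as a meet equation, [y <= f a] pulls back to [h y <= a]. *)
by rewrite leEmeet; apply/eqP/f_inj; rewrite fI hK; exact: meet_l.
Qed.

(** [B_nontrivial] excludes the one-element algebra: it is complete, vacuously atomfree, and the
    concept algebra of the empty context. *)
Theorem theorem4p1 (d : Order.disp_t) (B : ctbDistrLatticeType d)
    (B_nontrivial : (\bot : B)%O <> (\top : B)%O)
    (B_complete : complete_order B) (B_atomfree : atomfree B) :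
  ~ exists K : formal_context,
      isomorphic (concept_algebra K) (boolean_algebra B).
Proof.
case=> K [f [bij_f [[fI _ fC _] [f0 f1]]]] /=.
(* The law [meetxC] of [B] is pulled back along the injective [f]. *)
have wnegI (x : concept K) : (x `&` weak_negation x = \bot)%O.
  apply: (bij_inj bij_f); rewrite f0.
  by rewrite [LHS]fI [X in meet_op _ X]fC; exact: meetxC.
apply: B_nontrivial.
suff K01 : (\bot : concept K)%O = \top%O by rewrite -[LHS]f0 -[RHS]f1 /= K01.
apply: object_concept_eq0 => g; apply: contrapT => g_neq0.
apply: (B_atomfree (f (object_concept g))).
exact: atom_meet_iso bij_f fI f0 (object_concept_atom g wnegI g_neq0).
Qed.
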